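(* Let $X\subset\mathbb{R}^k$ be a closed definable set and let $x_0\in X$. If $x_0\notin\overline{M_X}$, then $$C_{x_0}X\subset\liminf_{X\ni x\to x_0}C_xX .$$
   Context: Fix an o-minimal structure expanding the field $\mathbb{R}$; ''definable'' means definable in it. Euclidean spaces carry the Euclidean norm. For a closed nonempty $X\subset\mathbb{R}^k$ and $a\in\mathbb{R}^k$ put $d(a,X)=\inf\{\|a-x\| : x\in X\}$ and $m(a)=\{x\in X : \|a-x\|=d(a,X)\}$. The medial axis of $X$ is $M_X=\{a\in\mathbb{R}^k : \#m(a)>1\}$, and $\overline{M_X}$ is its closure. The (Peano) tangent cone of $X$ at $x\in X$ is $C_xX=\{v : \text{there exist } X\ni x_\nu\to x \text{ and } t_\nu\to0^+ \text{ with } (x_\nu-x)/t_\nu\to v\}$. Limits of sets are in the Kuratowski sense: $v\in\liminf_{X\ni x\to x_0}C_xX$ iff for every sequence $X\ni x_\nu\to x_0$ there are $v_\nu\in C_{x_\nu}X$ with $v_\nu\to v$. *)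

(* Defs.v *)
From HB Require Import structures.
From mathcomp Require Import all_boot all_order all_algebra.
From mathcomp Require Import all_classical all_reals all_analysis.

Set Implicit Arguments.
Unset Strict Implicit.
Unset Printing Implicit Defensive.

Import Order.TTheory GRing.Theory Num.Theory.
Import numFieldNormedType.Exports.

Local Open Scope classical_set_scope.
Local Open Scope ring_scope.

(* [definable S n A] reads "A is a definable subset of R^n".  A point is an
   interval [a, a], so [definable_line] says that the definable subsets of the
   line are exactly the finite unions of points and intervals.  In particular
   every singleton is definable: definability is with parameters.  The order
   needs no field of its own, x <= y being definable by "y - x is a square". *)
Record ominimal_field_structure (R : realType) := OminimalFieldStructure {
  definable : forall n, set (set 'rV[R]_n);
  definable0 : forall n, definable (set0 : set 'rV[R]_n);
  definableU : forall n (A B : set 'rV[R]_n),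
    definable A -> definable B -> definable (A `|` B);
  definableC : forall n (A : set 'rV[R]_n),
    definable A -> definable (~` A);
  definableX : forall m n (A : set 'rV[R]_m) (B : set 'rV[R]_n),
    definable A -> definable B ->
    definable [set z : 'rV[R]_(m + n) | A (lsubmx z) /\ B (rsubmx z)];
  definable_diag : forall n (i j : 'I_n),
    definable [set z : 'rV[R]_n | z 0 i = z 0 j];
  definable_proj : forall n (A : set 'rV[R]_(n + 1)),
    definable A -> definable ((fun z => lsubmx z) @` A : set 'rV[R]_n);
  definable_add :
    definable [set z : 'rV[R]_3 | z 0 ord_max = z 0 0 + z 0 1];
  definable_mul :
    definable [set z : 'rV[R]_3 | z 0 ord_max = z 0 0 * z 0 1];
  definable_line : forall B : set R,
    definable [set z : 'rV[R]_1 | B (z 0 0)] <->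
    exists s : seq (interval R), B = \bigcup_(i in [set` s]) [set` i]
}.

(* The norm `|v| of the library is the sup norm on 'rV[R]_k, which is why the
   distance is not built from it.  It induces the same topology, hence closures
   and limits below are the library's. *)
Definition euclidean_norm (R : realType) (k : nat) (v : 'rV[R]_k) : R :=
  Num.sqrt (\sum_(i < k) v 0 i ^+ 2).

Definition distance_to (R : realType) (k : nat) (X : set 'rV[R]_k)
    (a : 'rV[R]_k) : R :=
  inf [set euclidean_norm (a - x) | x in X].

Definition nearest_points (R : realType) (k : nat) (X : set 'rV[R]_k)
    (a : 'rV[R]_k) : set 'rV[R]_k :=
  [set x | X x /\ euclidean_norm (a - x) = distance_to X a].

Definition medial_axis (R : realType) (k : nat) (X : set 'rV[R]_k) :
    set 'rV[R]_k :=
  [set a | exists x y, [/\ nearest_points X a x, nearest_points X a y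
                         & x <> y]].

Definition tangent_cone (R : realType) (k : nat) (X : set 'rV[R]_k)
    (x : 'rV[R]_k) : set 'rV[R]_k :=
  [set v : 'rV[R]_k | exists (x_ : nat -> 'rV[R]_k) (t_ : nat -> R),
    [/\ forall n, X (x_ n),
        x_ @ \oo --> x,
        forall n, 0 < t_ n,
        t_ @ \oo --> (0 : R) &
        (fun n => (t_ n)^-1 *: (x_ n - x)) @ \oo --> v]].

(* Lower Kuratowski limit of F x as x tends to x0 within X; the value x0 itself
   is allowed along the sequences. *)
Definition kuratowski_liminf (R : realType) (k : nat) (X : set 'rV[R]_k)
    (x0 : 'rV[R]_k) (F : 'rV[R]_k -> set 'rV[R]_k) : set 'rV[R]_k :=
  [set v : 'rV[R]_k | forall x_ : nat -> 'rV[R]_k,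
    (forall n, X (x_ n)) -> x_ @ \oo --> x0 ->
    exists v_ : nat -> 'rV[R]_k,
      (forall n, F (x_ n) (v_ n)) /\ v_ @ \oo --> v].

(* Main.v *)
(* Let the ball B(x0, r) avoid the medial axis, d be the distance to X and p the
   nearest point map, single-valued and continuous on that ball.  Off X, d has
   slope 1 in the direction a - p(a), so a maximum point of d - (1 - e)|. - a|
   on a closed ball B(a, s) lies on its boundary, whence max d = d(a) + s there.
   Since d(b) <= |b - p(a)|, this maximum can only be attained on the ray from
   p(a) through a, so that p(a) is still nearest at distance d(a) + s:
     r <a - p(a), y - p(a)> <= |a - p(a)| |y - p(a)|^2    for y in X.
   Applying this at a = x + l (y - x), to both x and y, gives
   r |a - p(a)| <= 2 l |y - x|^2; letting l tend to 0 yields z in C_x X with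
   r |z - (y - x)| <= 2 |y - x|^2.  Scaling by 1 / t, where y = x0 + t v + o(t),
   puts points of C_x X arbitrarily near v for all x close enough to x0. *)
Require Import Defs.
From mathcomp Require Import all_boot all_order all_algebra.
From mathcomp Require Import all_classical all_reals all_analysis.
From mathcomp Require Import ring lra.
Import Order.TTheory GRing.Theory Num.Theory.
Import numFieldNormedType.Exports.
Set Implicit Arguments.
Unset Strict Implicit.
Local Open Scope classical_set_scope.
Local Open Scope ring_scope.

(** * Euclidean norm *)

Section EuclideanNorm.
Context {R : realType} {k : nat}.
Implicit Types (u v w x y : 'rV[R]_k) (t : R).

Definition dot u v : R := \sum_(i < k) u 0 i * v 0 i.

Lemma dotC u v : dot u v = dot v u.
Proof. by apply: eq_bigr => i _; rewrite mulrC. Qed.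

Lemma dotDl u v w : dot (u + v) w = dot u w + dot v w.
Proof. by rewrite -big_split; apply: eq_bigr => i _; rewrite mxE mulrDl. Qed.

Lemma dotZl t u v : dot (t *: u) v = t * dot u v.
Proof. by rewrite mulr_sumr; apply: eq_bigr => i _; rewrite mxE mulrA. Qed.

Lemma dotNl u v : dot (- u) v = - dot u v.
Proof. by rewrite -scaleN1r dotZl mulN1r. Qed.

Lemma dotDr u v w : dot w (u + v) = dot w u + dot w v.
Proof. by rewrite dotC dotDl !(dotC w). Qed.

Lemma dotZr t u v : dot v (t *: u) = t * dot v u.
Proof. by rewrite dotC dotZl dotC. Qed.

Lemma dotNr u v : dot v (- u) = - dot v u.
Proof. by rewrite dotC dotNl dotC. Qed.

Definition dotE := (dotDl, dotDr, dotZl, dotZr, dotNl, dotNr).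

Lemma dot_ge0 u : 0 <= dot u u.
Proof. by apply: sumr_ge0 => i _; rewrite -expr2 sqr_ge0. Qed.

Lemma enorm_ge0 u : 0 <= euclidean_norm u.
Proof. exact: sqrtr_ge0. Qed.

Lemma sqr_enorm u : euclidean_norm u ^+ 2 = dot u u.
Proof.
rewrite sqr_sqrtr; last by apply: sumr_ge0 => i _; rewrite sqr_ge0.
by apply: eq_bigr => i _; rewrite expr2.
Qed.

Lemma enorm_le u t : 0 <= t -> dot u u <= t ^+ 2 -> euclidean_norm u <= t.
Proof. by move=> t0; rewrite -sqr_enorm ler_sqr ?nnegrE ?enorm_ge0. Qed.

Lemma enormZ t u : euclidean_norm (t *: u) = `|t| * euclidean_norm u.
Proof.
apply/eqP; rewrite -(@eqrXn2 _ 2) ?mulr_ge0 ?enorm_ge0 //.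
by rewrite exprMn !sqr_enorm real_normK ?num_real// !dotE mulrA.
Qed.

Lemma enorm0 : euclidean_norm (0 : 'rV[R]_k) = 0.
Proof. by rewrite -(scale0r 0) enormZ normr0 mul0r. Qed.

Lemma enormN u : euclidean_norm (- u) = euclidean_norm u.
Proof. by rewrite -scaleN1r enormZ normrN1 mul1r. Qed.

Lemma enormBC u v : euclidean_norm (u - v) = euclidean_norm (v - u).
Proof. by rewrite -enormN opprB. Qed.

Lemma normr_le_enorm u : `|u| <= euclidean_norm u.
Proof.
rewrite [leLHS]/Num.norm /= mx_normrE; apply/bigmax_leP; split=> [|[i j] _ /=].
  exact: enorm_ge0.
rewrite ord1 -ler_sqr ?nnegrE ?enorm_ge0// real_normK ?num_real// sqr_enorm.
rewrite /dot (bigD1 j)//= expr2 lerDl.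
by apply: sumr_ge0 => l _; rewrite -expr2 sqr_ge0.
Qed.

(** The crude factor [k.+1], larger than the square root of [k], is positive even for [k = 0], so it
    can be divided by. *)
Lemma enorm_le_normr u : euclidean_norm u <= k.+1%:R * `|u|.
Proof.
apply: enorm_le; first by rewrite mulr_ge0.
have uE j : `|u 0 j| <= `|u|.
  rewrite [leRHS]/Num.norm /= mx_normrE.
  by apply/bigmax_geP; right; exists (0, j).
apply: (@le_trans _ _ (\sum_(i < k) `|u| ^+ 2)).
  apply: ler_sum => i _; rewrite -expr2 -real_normK ?num_real//.
  by rewrite lerXn2r ?nnegrE.
rewrite sumr_const card_ord exprMn -(mulr_natl (_ ^+ 2)) ler_wpM2r ?sqr_ge0//.
by rewrite -natrX ler_nat expnS (leq_trans (leqnSn _))// leq_pmulr// expn_gt0.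
Qed.

Lemma enorm_eq0 u : euclidean_norm u = 0 -> u = 0.
Proof.
move=> u0; apply/eqP; rewrite -normr_eq0 eq_le normr_ge0 andbT -u0.
exact: normr_le_enorm.
Qed.

Lemma enorm_gt0 u : u <> 0 -> 0 < euclidean_norm u.
Proof.
by move=> u0; rewrite lt_neqAle enorm_ge0 andbT eq_sym; apply/eqP => /enorm_eq0.
Qed.

(** Cauchy-Schwarz: expand the squared norm of |v| u - |u| v and cancel |u| |v|, with zero vectors
    treated apart. *)
Lemma dot_le_enorm u v : dot u v <= euclidean_norm u * euclidean_norm v.
Proof.
have [/enorm_eq0 ->|u0] := eqVneq (euclidean_norm u) 0.
  by rewrite -(scale0r 0) dotZl mul0r mulr_ge0 ?enorm_ge0.
have [/enorm_eq0 ->|v0] := eqVneq (euclidean_norm v) 0.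
  by rewrite -(scale0r 0) dotZr mul0r mulr_ge0 ?enorm_ge0.
have uv0 : 0 < euclidean_norm u * euclidean_norm v.
  by rewrite mulr_gt0// lt_neqAle enorm_ge0 eq_sym andbT.
have := dot_ge0 (euclidean_norm v *: u - euclidean_norm u *: v).
rewrite !dotE -!sqr_enorm (dotC v u) => h; rewrite -(ler_pM2l uv0).
move: h; set a := euclidean_norm u; set b := euclidean_norm v; lra.
Qed.

Lemma enormD u v : euclidean_norm (u + v) <= euclidean_norm u + euclidean_norm v.
Proof.
apply: enorm_le; first by rewrite addr_ge0 ?enorm_ge0.
by rewrite !dotE sqrrD !sqr_enorm (dotC v u); have := dot_le_enorm u v; lra.
Qed.

Lemma sqr_enormB u v : euclidean_norm (u - v) ^+ 2 =
  euclidean_norm u ^+ 2 - 2 * dot u v + euclidean_norm v ^+ 2.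
Proof. by rewrite !sqr_enorm !dotE (dotC v u); ring. Qed.

(** The equality case of the triangle inequality. Squaring the hypothesis gives |u| |v| <= <u, v>,
    while |v| u - |u| v has squared norm 2 |u| |v| (|u| |v| - <u, v>). *)
Lemma enormD_eq u v :
  euclidean_norm u + euclidean_norm v <= euclidean_norm (u + v) ->
  euclidean_norm v *: u = euclidean_norm u *: v.
Proof.
rewrite -ler_sqr ?nnegrE ?addr_ge0 ?enorm_ge0// sqr_enorm !dotE -!sqr_enorm.
rewrite (dotC v u); set a := euclidean_norm u; set b := euclidean_norm v => h.
apply/eqP; rewrite -subr_eq0; apply/eqP/enorm_eq0/eqP.
rewrite eq_le enorm_ge0 andbT; apply: enorm_le => //.
rewrite !dotE -!sqr_enorm -/a -/b (dotC v u) expr0n/=.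
have ab : a * b <= dot u v by lra.
have : a * b * (a * b) <= a * b * dot u v by rewrite ler_wpM2l ?mulr_ge0 ?enorm_ge0.
lra.
Qed.

Lemma enorm_triangle w u v :
  euclidean_norm (u - v) <= euclidean_norm (u - w) + euclidean_norm (w - v).
Proof. by apply: le_trans (enormD _ _); rewrite addrA subrK. Qed.

Lemma lipschitz_continuous (f : 'rV[R]_k -> R) t :
  (forall x y, f x - f y <= t * euclidean_norm (x - y)) -> continuous f.
Proof.
move=> fL x; apply/(@cvgrPdist_lt _ _ _ (nbhs x)) => e e0.
(* The [+ 1] keeps the sup-norm Lipschitz constant positive, so that [e] can be divided by it. *)
have M0 : 0 < `|t| * k.+1%:R + 1 by rewrite ltr_wpDl// mulr_ge0.
apply/(@nbhs_normP R 'rV[R]_k); exists (e / (`|t| * k.+1%:R + 1)); first exact: divr_gt0.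
move=> y; rewrite /= => xy.
have fB u v : f u - f v <= (`|t| * k.+1%:R + 1) * `|u - v|.
  apply: le_trans (fL u v) _; rewrite mulrDl mul1r -mulrA.
  apply: le_trans (_ : `|t| * (k.+1%:R * `|u - v|) <= _); last by rewrite lerDl.
  apply: le_trans (_ : `|t| * euclidean_norm (u - v) <= _).
    by rewrite ler_wpM2r ?enorm_ge0// ler_norm.
  by rewrite ler_wpM2l// enorm_le_normr.
apply: (@le_lt_trans _ _ ((`|t| * k.+1%:R + 1) * `|x - y|)).
  by rewrite ler_norml lerNl opprB fB andbT distrC fB.
by rewrite mulrC -ltr_pdivlMr.
Qed.

Lemma enormB_continuous w : continuous (fun x => euclidean_norm (x - w)).
Proof.
apply: (@lipschitz_continuous _ 1) => x y.
by rewrite mul1r lerBlDr; apply: enorm_triangle.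
Qed.

(** Limits are defined through the sup norm; equivalence of the two norms lets all later estimates
    be Euclidean. *)
Lemma cvg_enormP {T : Type} {F : set_system T} {FF : Filter F}
    (f : T -> 'rV[R]_k) u :
  f @ F --> u <->
  forall e, 0 < e -> \forall i \near F, euclidean_norm (f i - u) < e.
Proof.
split=> [/(@cvgrPdist_lt _ 'rV[R]_k _ F FF) fu e e0|fu].
  have M0 : 0 < (k.+1%:R : R) by rewrite ltr0n.
  have := fu _ (divr_gt0 e0 M0).
  apply: filterS => i /=; rewrite distrC ltr_pdivlMr// mulrC.
  exact/le_lt_trans/enorm_le_normr.
apply/(@cvgrPdist_lt _ 'rV[R]_k _ F FF) => e /fu; apply: filterS => i.
by rewrite distrC; apply/le_lt_trans/normr_le_enorm.
Qed.

Lemma closed_enorm_ball w t : closed [set x | euclidean_norm (x - w) <= t].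
Proof.
rewrite -[X in closed X]/((fun x => euclidean_norm (x - w)) @^-1` [set s | s <= t]).
by apply: closed_comp; [move=> x _; apply: enormB_continuous|exact: closed_le].
Qed.

Lemma compact_enorm_ball (X : set 'rV[R]_k) w t :
  closed X -> compact (X `&` [set x | euclidean_norm (x - w) <= t]).
Proof.
move=> Xcl; apply: bounded_closed_compact; last first.
  exact: closedI Xcl (@closed_enorm_ball w t).
exists (t + euclidean_norm w); split; first exact: num_real.
move=> M tM x [_ /= xt]; apply/ltW/(le_lt_trans _ tM).
apply: le_trans (normr_le_enorm x) _.
have := enormD (x - w) w; rewrite subrK => /le_trans; apply.
by rewrite lerD2r.
Qed.

End EuclideanNorm.

(** * Nearest points *)

Section NearestPoints.
Context {R : realType} {k : nat} {X : set 'rV[R]_k}.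
Hypothesis X_closed : closed X.
Implicit Types (a b p q u w x y : 'rV[R]_k) (e s t : R).

Lemma distance_to_le a y : X y -> distance_to X a <= euclidean_norm (a - y).
Proof.
move=> Xy; apply: ge_inf; last by exists y.
by exists 0 => _ [z _ <-]; exact: enorm_ge0.
Qed.

Lemma nearest_pointsP a p :
  nearest_points X a p <->
  X p /\ forall y, X y -> euclidean_norm (a - p) <= euclidean_norm (a - y).
Proof.
split=> [[Xp ap]|[Xp pmin]]; split => //.
  by move=> y Xy; rewrite ap distance_to_le.
apply/eqP; rewrite eq_le distance_to_le// andbT.
apply: lb_le_inf => [|_ [y Xy <-]]; last exact: pmin.
by exists (euclidean_norm (a - p)), p.
Qed.

Lemma nearest_points_nonempty a : X !=set0 -> nearest_points X a !=set0.
Proof.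
move=> [x0 Xx0].
(* Points of [X] farther from [a] than [x0] cannot be nearest, so minimising over this compact set
   suffices. *)
pose K := X `&` [set x | euclidean_norm (x - a) <= euclidean_norm (x0 - a)].
have [|||p /[!inE] -[Xp pa] pmin] := @EVT_min_rV R k (fun x => euclidean_norm (x - a)) K.
- by exists x0; split => /=.
- exact: compact_enorm_ball.
- exact/continuous_subspaceT/enormB_continuous.
exists p; apply/nearest_pointsP; split=> // y Xy.
rewrite !(enormBC a).
have [ya|/ltW] := leP (euclidean_norm (y - a)) (euclidean_norm (x0 - a)).
  by apply: pmin; rewrite inE; split.
exact: le_trans.
Qed.

Lemma distance_to_lipschitz a b : X !=set0 ->
  distance_to X a - distance_to X b <= 1 * euclidean_norm (a - b).
Proof.
move=> /(nearest_points_nonempty b)[p [Xp <-]].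
rewrite mul1r lerBlDr; apply: le_trans (distance_to_le a Xp) _.
exact: enorm_triangle.
Qed.

Lemma distance_to_gt0 a : X !=set0 -> ~ X a -> 0 < distance_to X a.
Proof.
move=> /(nearest_points_nonempty a)[p [Xp <-]] Xa; apply: enorm_gt0.
by move/eqP; rewrite subr_eq0 => /eqP ap; apply: Xa; rewrite ap.
Qed.

Lemma distance_to_ge0 a : X !=set0 -> 0 <= distance_to X a.
Proof. by move=> /(nearest_points_nonempty a)[p [_ <-]]; exact: enorm_ge0. Qed.

Lemma distance_to_mem a : X a -> distance_to X a = 0.
Proof.
move=> Xa; apply/eqP; rewrite eq_le distance_to_ge0 ?andbT; last by exists a.
by rewrite -[leRHS](enorm0 (k := k)) -(subrr a) distance_to_le.
Qed.

Lemma nearest_points_unique a p q : ~ medial_axis X a ->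
  nearest_points X a p -> nearest_points X a q -> p = q.
Proof. by move=> aM ap aq; apply: contrapT => pq; apply: aM; exists p, q. Qed.

(** Continuity of the projection at [b]. By compactness and uniqueness of [p], points of [K'] are
    farther from [b] than d(b) by a positive gap, whereas a nearest point of [c] is within d(b) + 2
    |c - b| of [b]. *)
Lemma nearest_points_stable b p e : 0 < e -> ~ medial_axis X b ->
  nearest_points X b p ->
  exists2 t, 0 < t & forall c q, euclidean_norm (c - b) < t ->
    nearest_points X c q -> euclidean_norm (q - p) < e.
Proof.
move=> e0 bM bp; have [Xp bpE] := bp.
have X0 : X !=set0 by exists p.
(* For |c - b| < 1 the bound d(b) + 2 |c - b| puts every nearest point of [c] in [K]. *)
pose K := X `&` [set x | euclidean_norm (x - b) <= distance_to X b + 2].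
pose K' := K `&` [set x | e <= euclidean_norm (x - p)].
have [K'0|K'0] := pselect (K' !=set0); last first.
  exists 1 => // c q cb [Xq cq]; rewrite ltNge; apply/negP => eqp.
  apply: K'0; exists q; split=> //; split => //=.
  have := distance_to_lipschitz c b X0; have := enorm_triangle c q b.
  by rewrite (enormBC q c) cq; lra.
have [||m /[!inE] -[[Xm mb] em] mmin] :=
    @EVT_min_rV R k (fun x => euclidean_norm (x - b)) K' K'0.
- apply: compact_closedI; first exact: compact_enorm_ball.
  rewrite -[X in closed X]/((fun x => euclidean_norm (x - p)) @^-1` [set s | e <= s]).
  by apply: closed_comp; [move=> x _; apply: enormB_continuous|exact: closed_ge].
- exact/continuous_subspaceT/enormB_continuous.
have dm : distance_to X b < euclidean_norm (m - b).
  rewrite enormBC lt_neqAle distance_to_le// andbT; apply/eqP => bm.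
  have mp : m = p by apply: (nearest_points_unique bM).
  by move: em; rewrite /= mp subrr enorm0 leNgt e0.
exists (Num.min 1 ((euclidean_norm (m - b) - distance_to X b) / 2)).
  by rewrite lt_min ltr01 divr_gt0// subr_gt0.
move=> c q; rewrite lt_min => /andP[cb1 cb2] [Xq cq].
rewrite ltNge; apply/negP => eqp.
have := distance_to_lipschitz c b X0; have := enorm_triangle c q b.
rewrite (enormBC q c) cq => h1 h2.
have /mmin : q \in K' by rewrite inE; split=> //; split => //=; lra.
lra.
Qed.

End NearestPoints.

(** * Projection off the medial axis *)

Section OffMedialAxis.
Context {R : realType} {k : nat} {X : set 'rV[R]_k}.
Hypothesis X_closed : closed X.
Implicit Types (a b p q u w x y : 'rV[R]_k) (e r s t : R).

(** For [c] at distance h from [b] in the direction b - p, a nearest point q is close to [p], so <b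
    - p, b - q> >= (1 - e) d^2. Hence |c - q|^2 >= d^2 + 2 (1 - e) d h + h^2, which exceeds (d + (1
    - e) h)^2. *)
Lemma distance_to_ascent b p e : 0 < e -> e < 1 -> ~ X b -> ~ medial_axis X b ->
  nearest_points X b p ->
  exists2 t, 0 < t & forall h, 0 < h -> h < t ->
    distance_to X b + (1 - e) * h <
    distance_to X (b + (h / distance_to X b) *: (b - p)).
Proof.
move=> e0 e1 Xb bM bp; have [Xp bpE] := bp.
have X0 : X !=set0 by exists p.
have d0 := distance_to_gt0 X_closed X0 Xb; set d := distance_to X b in d0 bpE *.
have [t t0 tstable] := nearest_points_stable X_closed (mulr_gt0 e0 d0) bM bp.
exists t => // h h0 ht; set c := b + _.
have [q cq] := nearest_points_nonempty X_closed c X0; have [Xq cqE] := cq.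
have /tstable/(_ cq) qp : euclidean_norm (c - b) < t.
  by rewrite /c addrAC subrr add0r enormZ gtr0_norm ?divr_gt0// bpE divfK ?gt_eqF.
have dbq : d ^+ 2 <= dot (b - q) (b - q).
  rewrite -sqr_enorm lerXn2r ?nnegrE ?enorm_ge0 ?(ltW d0)//.
  exact: distance_to_le.
have bq : d * d - e * d * d <= dot (b - p) (b - q).
  have := dot_le_enorm (b - p) (q - p); rewrite bpE => pq.
  have : d * euclidean_norm (q - p) <= d * (e * d) by rewrite ler_pM2l// ltW.
  have : dot (b - p) (b - q) = dot (b - p) (b - p) - dot (b - p) (q - p).
    by rewrite -dotNr -dotDr; congr dot; rewrite opprB addrA subrK.
  by rewrite -sqr_enorm bpE; lra.
have cqsq : dot (c - q) (c - q) =
    dot (b - q) (b - q) + 2 * (h / d) * dot (b - p) (b - q) + h ^+ 2.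
  have -> : c - q = (b - q) + (h / d) *: (b - p) by rewrite /c addrAC.
  rewrite [LHS]dotDl [in LHS]dotDr [dot (_ *: _) _]dotDr dotZl dotZr dotZl dotZr.
  rewrite -(sqr_enorm (b - p)) bpE (dotC (b - q)).
  by field; rewrite gt_eqF.
have {}bq : h * d - h * (e * d) <= h / d * dot (b - p) (b - q).
  have -> : h * d - h * (e * d) = h / d * (d * d - e * d * d).
    by field; rewrite gt_eqF.
  by rewrite ler_pM2l ?divr_gt0.
rewrite -cqE ltNge; apply/negP => cqle.
have : dot (c - q) (c - q) <= (d + (1 - e) * h) ^+ 2.
  rewrite -sqr_enorm lerXn2r ?nnegrE ?enorm_ge0//.
  by rewrite addr_ge0 ?mulr_ge0 ?subr_ge0 ?ltW.
have : ((1 - e) * h) ^+ 2 < h ^+ 2.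
  by rewrite ltrXn2r ?nnegrE ?mulr_ge0 ?subr_ge0 ?ltW// gtr_pMl// gtrBl.
by rewrite cqsq sqrrD -/d; lra.
Qed.

(** At a maximum of [f] inside the ball, [distance_to_ascent] would raise the distance by more than
    (1 - e) h while |. - a| grows by at most h. So the maximum lies on the sphere, and comparison
    with [f a] gives the bound. *)
Lemma distance_to_max_on_ball a s e : X !=set0 -> ~ X a -> 0 <= s ->
  (forall b, euclidean_norm (b - a) <= s -> ~ medial_axis X b) ->
  0 < e -> e < 1 ->
  exists b, euclidean_norm (b - a) <= s /\
    distance_to X a + (1 - e) * s <= distance_to X b.
Proof.
move=> X0 Xa s0 aM e0 e1.
pose f b := distance_to X b - (1 - e) * euclidean_norm (b - a).
have fL x y : f x - f y <= 2 * euclidean_norm (x - y).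
  have := distance_to_lipschitz X_closed x y X0.
  have : (1 - e) * (euclidean_norm (y - a) - euclidean_norm (x - a)) <=
      (1 - e) * euclidean_norm (x - y).
    rewrite ler_wpM2l ?subr_ge0 ?(ltW e1)// lerBlDr (enormBC x y).
    exact: enorm_triangle.
  have : 0 <= e * euclidean_norm (x - y) by rewrite mulr_ge0 ?enorm_ge0// ltW.
  by rewrite /f; lra.
have [|||b /[!inE] -[_ /= bs] bmax] := @EVT_max_rV R k f
  (setT `&` [set x | euclidean_norm (x - a) <= s]).
- by exists a; split => //=; rewrite subrr enorm0.
- by apply: compact_enorm_ball; exact: closedT.
- exact/continuous_subspaceT/(lipschitz_continuous fL).
have bd : distance_to X a + (1 - e) * euclidean_norm (b - a) <= distance_to X b.
  have /bmax : a \in setT `&` [set x | euclidean_norm (x - a) <= s].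
    by rewrite inE; split=> //=; rewrite subrr enorm0.
  by rewrite /f subrr enorm0; lra.
exists b; split => //.
have [bas|bas] := eqVneq (euclidean_norm (b - a)) s; first by rewrite -bas.
exfalso.
have {bas} bas : euclidean_norm (b - a) < s by rewrite lt_neqAle bas.
(* The value of [f] at [b] is at least d(a) > 0, so [b] is off [X] and has an ascent direction. *)
have Xb : ~ X b.
  move=> Xb; have := distance_to_gt0 X_closed X0 Xa.
  have : 0 <= (1 - e) * euclidean_norm (b - a).
    by rewrite mulr_ge0 ?enorm_ge0// subr_ge0 ltW.
  by move: bd; rewrite (distance_to_mem X_closed Xb); lra.
have [p bp] := nearest_points_nonempty X_closed b X0.
have [t t0 tasc] := distance_to_ascent e0 e1 Xb (aM _ bs) bp.
have d0 := distance_to_gt0 X_closed X0 Xb.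
pose h := Num.min t (s - euclidean_norm (b - a)) / 2.
have h0 : 0 < h by rewrite divr_gt0// lt_min t0 subr_gt0.
have /andP[ht hs] : (h < t) && (h < s - euclidean_norm (b - a)).
  by rewrite -lt_min /h ltr_pdivrMr// ltr_pMr ?ltr1n// lt_min t0 subr_gt0.
have := tasc h h0 ht; set c := b + _ => hc.
have cb : euclidean_norm (c - b) = h.
  rewrite /c addrAC subrr add0r enormZ gtr0_norm; last exact: divr_gt0.
  by case: bp => _ ->; rewrite divfK ?gt_eqF.
have := enorm_triangle b c a; rewrite cb => ca.
have /bmax : c \in setT `&` [set x | euclidean_norm (x - a) <= s].
  by rewrite inE; split => //=; lra.
have : (1 - e) * euclidean_norm (c - a) <= (1 - e) * (h + euclidean_norm (b - a)).
  by rewrite ler_wpM2l// subr_ge0 ltW.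
by rewrite /f; lra.
Qed.

(** The open ball of radius d(a) about [a], free of points of [X], grows to one of radius d(a) + s
    that still touches [X] at [p], centred farther along the ray from [p] through [a]. The
    inequality says that [y] is outside it. *)
Lemma nearest_points_ball a p s : ~ X a -> nearest_points X a p -> 0 < s ->
  (forall b, euclidean_norm (b - a) <= s -> ~ medial_axis X b) ->
  forall y, X y ->
    2 * (distance_to X a + s) * dot (a - p) (y - p) <=
    distance_to X a * euclidean_norm (y - p) ^+ 2.
Proof.
move=> Xa [Xp apE] s0 aM y Xy.
have X0 : X !=set0 by exists p.
have d0 := distance_to_gt0 X_closed X0 Xa; set d := distance_to X a in d0 apE *.
have [|||b /[!inE] -[_ /= bs] bmax] := @EVT_max_rV R k (distance_to X)
  (setT `&` [set x | euclidean_norm (x - a) <= s]).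
- by exists a; split => //=; rewrite subrr enorm0 ltW.
- by apply: compact_enorm_ball; exact: closedT.
- apply: continuous_subspaceT; apply: (@lipschitz_continuous _ _ _ 1) => u v.
  exact: distance_to_lipschitz.
have db : d + s <= distance_to X b.
  rewrite leNgt; apply/negP => dbs.
  have dab : d <= distance_to X b.
    by apply: bmax; rewrite inE; split=> //=; rewrite subrr enorm0 ltW.
  (* Here e s is half the shortfall of the maximum below d + s, so the point [c] obtained from this
     [e] would beat the maximum. *)
  pose e := (d + s - distance_to X b) / (2 * s).
  have e0 : 0 < e by rewrite divr_gt0 ?subr_gt0 ?mulr_gt0.
  have e1 : e < 1 by rewrite ltr_pdivrMr ?mulr_gt0//; lra.
  have [c [cs dc]] := distance_to_max_on_ball X0 Xa (ltW s0) aM e0 e1.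
  have /bmax : c \in setT `&` [set x | euclidean_norm (x - a) <= s].
    by rewrite inE.
  have : e * s = (d + s - distance_to X b) / 2 by rewrite /e; field; rewrite gt_eqF.
  by move: dc; rewrite -/d; lra.
have ds0 : 0 <= d + s by rewrite addr_ge0 ?ltW.
have bpE : b - p = (b - a) + (a - p) by rewrite addrA subrK.
have bpds := le_trans db (distance_to_le b Xp).
have bsE : euclidean_norm (b - a) = s.
  apply: le_anti; rewrite bs/=.
  by have := enorm_triangle a b p; rewrite apE; lra.
(* Equality holds in the triangle inequality through [a], so b - a and a - p are parallel, of
   lengths s and d. *)
have wg : d *: (b - a) = s *: (a - p).
  by rewrite -bsE -apE; apply: enormD_eq; rewrite bsE apE -bpE addrC.
have dG z : d * dot (b - p) z = (d + s) * dot (a - p) z.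
  by rewrite bpE dotDl mulrDr -dotZl wg dotZl; ring.
have pb : euclidean_norm (b - p) <= d + s.
  by rewrite bpE; apply: le_trans (enormD _ _) _; rewrite apE bsE addrC.
(* Expanding |b - y|^2 about [p] turns this into 2 <b - p, y - p> <= |y - p|^2. *)
have : (d + s) ^+ 2 <= euclidean_norm (b - y) ^+ 2.
  by rewrite lerXn2r ?nnegrE ?enorm_ge0//; exact: le_trans db (distance_to_le b Xy).
have -> : b - y = (b - p) - (y - p) by rewrite opprB addrA subrK.
rewrite sqr_enormB => h; rewrite -mulrA -dG mulrCA ler_pM2l//.
have : euclidean_norm (b - p) ^+ 2 <= (d + s) ^+ 2.
  by rewrite lerXn2r ?nnegrE ?enorm_ge0.
lra.
Qed.

(** Federer's inequality for reach r / 2: the closed ball of that radius about [a] avoids the medial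
    axis, and 2 (d(a) + r / 2) >= r. *)
Lemma nearest_points_prox x0 r a p y :
  (forall b, euclidean_norm (b - x0) < r -> ~ medial_axis X b) ->
  euclidean_norm (a - x0) < r / 2 -> nearest_points X a p -> X y ->
  r * dot (a - p) (y - p) <= euclidean_norm (a - p) * euclidean_norm (y - p) ^+ 2.
Proof.
move=> x0M ax0 ap Xy; have [Xp apE] := ap.
have r0 : 0 < r / 2 by apply: le_lt_trans ax0; exact: enorm_ge0.
have [Xa|Xa] := pselect (X a).
  have -> : a - p = 0 by apply: enorm_eq0; rewrite apE distance_to_mem.
  by rewrite enorm0 mul0r -(scale0r 0) dotZl mul0r mulr0.
rewrite apE; have [|h] := leP (dot (a - p) (y - p)) 0.
  move=> /(mulr_ge0_le0 (_ : 0 <= r)) h; apply: le_trans (h _) _; first lra.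
  by rewrite mulr_ge0 ?exprn_ge0 ?enorm_ge0 ?distance_to_ge0//; exists p.
apply: le_trans (nearest_points_ball Xa ap r0 _ Xy); last first.
  by move=> b ba; apply: x0M; have := enorm_triangle a b x0; lra.
by rewrite ler_pM2r//; have := distance_to_ge0 X_closed a (ex_intro _ p Xp); lra.
Qed.

Lemma nearest_points_segment x0 r x y q l :
  (forall b, euclidean_norm (b - x0) < r -> ~ medial_axis X b) ->
  X x -> X y -> 0 < l -> l < 1 ->
  euclidean_norm (x + l *: (y - x) - x0) < r / 2 ->
  l * euclidean_norm (y - x) <= r / 2 ->
  nearest_points X (x + l *: (y - x)) q ->
  r * euclidean_norm (x + l *: (y - x) - q) <= 2 * l * euclidean_norm (y - x) ^+ 2.
Proof.
move=> x0M Xx Xy l0 l1; set a := x + _ => ax0 lr aq; have [Xq aqE] := aq.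
have px := nearest_points_prox x0M ax0 aq Xx.
have py := nearest_points_prox x0M ax0 aq Xy.
(* Lets |a - q|^2 be absorbed at the end into half of r |a - q|. *)
have Ar : euclidean_norm (a - q) <= r / 2.
  rewrite aqE; apply: le_trans (distance_to_le a Xx) _.
  by rewrite /a addrAC subrr add0r enormZ gtr0_norm.
have [->|A0] := eqVneq (euclidean_norm (a - q)) 0.
  by rewrite mulr0 mulr_ge0 ?exprn_ge0 ?enorm_ge0// mulr_ge0 ?ltW.
have {}A0 : 0 < euclidean_norm (a - q) by rewrite lt_neqAle eq_sym A0 enorm_ge0.
set A := euclidean_norm (a - q) in px py Ar A0 *.
have aE : a - q = (1 - l) *: (x - q) + l *: (y - q).
  by apply/rowP => i; rewrite !mxE; ring.
have yxE : y - x = (y - q) - (x - q) by rewrite opprB addrA subrK.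
(* Stewart's identity for [a] on the segment from [x] to [y], seen from [q]. *)
have convex : (1 - l) * euclidean_norm (x - q) ^+ 2 + l * euclidean_norm (y - q) ^+ 2
    = A ^+ 2 + l * (1 - l) * euclidean_norm (y - x) ^+ 2.
  rewrite /A aE yxE; move: (x - q) (y - q) => u v.
  by rewrite !sqr_enorm !dotE (dotC v u); ring.
(* Since a - q is the combination of x - q and y - q with weights 1 - l and l, adding [px] and [py]
   with these weights gives r |a - q|^2 on the left. *)
have : r * A ^+ 2 <= A * (A ^+ 2 + l * (1 - l) * euclidean_norm (y - x) ^+ 2).
  rewrite -convex {1}/A sqr_enorm {2}aE dotDr !dotZr.
  have := ler_wpM2l (_ : 0 <= 1 - l) px; have := ler_wpM2l (ltW l0) py.
  by move=> h1 /(_ _) h2; have := h2 ltac:(lra); lra.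
rewrite expr2 mulrCA ler_pM2l// => h.
have : A * A <= r / 2 * A by rewrite ler_pM2r.
have : 0 <= l * (l * euclidean_norm (y - x) ^+ 2).
  by rewrite !mulr_ge0 ?exprn_ge0 ?enorm_ge0// ltW.
lra.
Qed.

End OffMedialAxis.

(** * Tangent cones *)

Section TangentCones.
Context {R : realType} {k : nat} {X : set 'rV[R]_k}.
Implicit Types (u v w x y z : 'rV[R]_k) (e r s t : R).

Lemma near_inv_lt e : 0 < e -> \forall n \near \oo, n.+1%:R^-1 < e.
Proof. by move=> e0; exact: (near_infty_natSinv_lt (PosNum e0)). Qed.

(** Sequences come from the choices e = 1 / (n + 1); the error is measured relative to [t] because
    the difference quotient divides by [t]. *)
Lemma tangent_coneI x v :
  (forall e, 0 < e -> exists y t, [/\ X y, 0 < t, t < e &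
    euclidean_norm (y - x - t *: v) <= e * t]) ->
  tangent_cone X x v.
Proof.
move=> H.
have /choice[f fP] (n : nat) : exists f : 'rV[R]_k * R,
    [/\ X f.1, 0 < f.2, f.2 < n.+1%:R^-1 &
      euclidean_norm (f.1 - x - f.2 *: v) <= n.+1%:R^-1 * f.2].
  have [|y [t ?]] := H n.+1%:R^-1; first by rewrite invr_gt0.
  by exists (y, t).
exists (fun n => (f n).1), (fun n => (f n).2); split.
- by move=> n; have [] := fP n.
- apply/cvg_enormP => e e0.
  have M0 : 0 < euclidean_norm v + 1 by rewrite ltr_wpDl ?enorm_ge0.
  near=> n; have [_ t0 tn fn] := fP n.
  have n1 : n.+1%:R^-1 <= 1 :> R by rewrite invf_le1// ler1n.
  have : n.+1%:R^-1 < e / (euclidean_norm v + 1).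
    by near: n; apply: near_inv_lt; exact: divr_gt0.
  rewrite ltr_pdivlMr//; apply: le_lt_trans.
  apply: (@le_trans _ _ ((f n).2 * (euclidean_norm v + 1))); last first.
    by rewrite ler_pM2r// ltW.
  have := enorm_triangle ((f n).2 *: v) ((f n).1 - x) 0.
  rewrite !subr0 enormZ (gtr0_norm t0) => /le_trans; apply.
  rewrite mulrDr mulr1 addrC lerD2l; apply: le_trans fn _.
  by rewrite -[leRHS]mul1r ler_pM2r.
- by move=> n; have [] := fP n.
- apply/cvgrPdist_lt => e e0; near=> n; have [_ t0 tn _] := fP n.
  rewrite sub0r normrN gtr0_norm//; apply: lt_trans tn _.
  by near: n; exact: near_inv_lt.
- apply/cvg_enormP => e e0; near=> n; have [_ t0 _ fn] := fP n.
  have : n.+1%:R^-1 < e by near: n; exact: near_inv_lt.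
  apply: le_lt_trans.
  have -> : (f n).2^-1 *: ((f n).1 - x) - v
      = (f n).2^-1 *: ((f n).1 - x - (f n).2 *: v).
    by rewrite [in RHS]scalerBr scalerA mulVf ?gt_eqF// scale1r.
  by rewrite enormZ gtr0_norm ?invr_gt0// ler_pdivrMl// mulrC.
Unshelve. all: by end_near. Qed.

Lemma tangent_cone0 x : X x -> tangent_cone X x 0.
Proof.
move=> Xx; apply: tangent_coneI => e e0; exists x, (e / 2).
rewrite subrr scaler0 subr0 enorm0; split => //; [lra|lra|].
by rewrite mulr_ge0 ?divr_ge0 ?ltW.
Qed.

Lemma tangent_coneZ x v s : 0 < s -> tangent_cone X x v -> tangent_cone X x (s *: v).
Proof.
move=> s0 [x_ [t_ [Xx xx t0 tt xv]]].
exists x_, (fun n => s^-1 * t_ n); split=> //.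
- by move=> n; rewrite mulr_gt0 ?invr_gt0.
- by rewrite -(mulr0 s^-1); apply: cvgMr.
- under eq_fun do rewrite invfM invrK -scalerA.
  exact: cvgZr.
Qed.

(* The tangent vector is a limit of (q - x) / l as l -> 0, where q is the
   projection of x + l (y - x) onto X. *)
Lemma tangent_cone_approx x0 r x y : closed X ->
  (forall b, euclidean_norm (b - x0) < r -> ~ medial_axis X b) ->
  X x -> X y -> euclidean_norm (x - x0) < r / 2 ->
  exists2 z, tangent_cone X x z &
    r * euclidean_norm (z - (y - x)) <= 2 * euclidean_norm (y - x) ^+ 2.
Proof.
move=> Xcl x0M Xx Xy xx0; set w := y - x.
have r0 : 0 < r by have := enorm_ge0 (x - x0); lra.
have w0 := enorm_ge0 w.
have m0 : 0 < (r / 2 - euclidean_norm (x - x0)) / (euclidean_norm w + 1).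
  by rewrite divr_gt0 ?subr_gt0// ltr_wpDl.
(* For l < m the two bounds give l < 1 and keep x + l w within r / 2 of [x0]. *)
pose m := Num.min 1 ((r / 2 - euclidean_norm (x - x0)) / (euclidean_norm w + 1)).
have {}m0 : 0 < m by rewrite lt_min ltr01.
have step l : 0 < l -> l < m -> exists g, X (x + l *: g) /\
    r * euclidean_norm (g - w) <= 2 * euclidean_norm w ^+ 2.
  rewrite lt_min => l0 /andP[l1]; rewrite ltr_pdivlMr; last by rewrite ltr_wpDl.
  move=> lw.
  have lE : euclidean_norm (l *: w) = l * euclidean_norm w.
    by rewrite enormZ gtr0_norm.
  have [q aq] := nearest_points_nonempty Xcl (x + l *: w) (ex_intro _ x Xx).
  have [Xq _] := aq.
  have := @nearest_points_segment _ _ _ Xcl x0 r x y q l x0M Xx Xy l0 l1.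
  (* The difference of this vector and [w] is (q - (x + l w)) / l, so the factor l cancels and the
     estimate is uniform in l. *)
  rewrite -/w => /(_ _ _ aq) h; exists (l^-1 *: (q - x)).
  rewrite scalerA mulfV ?gt_eqF// scale1r addrC subrK; split => //.
  have -> : l^-1 *: (q - x) - w = l^-1 *: (q - (x + l *: w)).
    by apply/rowP => i; rewrite !mxE; field; rewrite gt_eqF.
  rewrite enormZ gtr0_norm ?invr_gt0// mulrCA ler_pdivrMl// enormBC.
  rewrite mulrA (mulrC l); apply: h.
    by have := enormD (x - x0) (l *: w); rewrite addrAC lE; lra.
  have := enorm_ge0 (x - x0); lra.
(* Division by n + 2 makes the step smaller than [m] already at n = 0. *)
have /choice[g gP] (n : nat) : exists g, X (x + (m / n.+2%:R) *: g) /\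
    r * euclidean_norm (g - w) <= 2 * euclidean_norm w ^+ 2.
  by apply: step; rewrite ?divr_gt0// ltr_pdivrMr// ltr_pMr// ltr1n.
(* The uniform estimate confines all [g n] to a compact ball; a cluster point is the tangent vector
   sought. *)
pose K := setT `&` [set z | euclidean_norm (z - w) <= 2 * euclidean_norm w ^+ 2 / r].
have Kc : compact K by apply: compact_enorm_ball; exact: closedT.
have [|z [[_ /= zw] zg]] := Kc (g @ \oo) _.
  apply: (@filterE _ \oo) => n; split=> //=; rewrite ler_pdivlMr// mulrC.
  by have [] := gP n.
exists z; last by rewrite mulrC -ler_pdivlMr.
apply: tangent_coneI => e e0.
have e1 : nbhs z [set u | euclidean_norm (u - z) < e].
  by move/cvg_enormP : (@cvg_id _ (nbhs z)); exact.
(* Clustering yields some index only; this set forces its step below [e]. *)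
have e2 : \forall n \near \oo, (g @` [set n | m / n.+2%:R < e]) (g n).
  near=> n; exists n => //=; rewrite ltr_pdivrMr//.
  have : n.+1%:R^-1 < e / m by near: n; apply: near_inv_lt; exact: divr_gt0.
  rewrite ltr_pdivlMr// mulrC ltr_pdivrMr// => /lt_trans; apply.
  by rewrite ltr_pM2l// ltr_nat.
have [_ [[n /= ne <-] gz]] := zg _ _ e2 e1.
have [Xg _] := gP n.
have l0 : 0 < m / n.+2%:R by rewrite divr_gt0.
exists (x + (m / n.+2%:R) *: g n), (m / n.+2%:R); split => //.
rewrite (addrC x) addrK -scalerBr enormZ gtr0_norm// mulrC ler_pM2r//.
exact: ltW.
Unshelve. all: by end_near. Qed.

End TangentCones.

(** * Lower limits and the inclusion of tangent cones *)

(** One sequence must serve every e: [v_ n] is taken within 1 / (n + 1) of the infimal distance from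
    [v] to [F (x_ n)], which need not be attained. *)
Lemma kuratowski_liminfI (R : realType) (k : nat) (X : set 'rV[R]_k)
    (x0 v : 'rV[R]_k) (F : 'rV[R]_k -> set 'rV[R]_k) :
  (forall x, X x -> F x !=set0) ->
  (forall e, 0 < e -> exists2 d, 0 < d & forall x, X x ->
     euclidean_norm (x - x0) < d ->
     exists2 z, F x z & euclidean_norm (z - v) < e) ->
  kuratowski_liminf X x0 F v.
Proof.
move=> F0 H x_ Xx xx0.
pose D n := [set euclidean_norm (z - v) | z in F (x_ n)].
have Dlb n : has_lbound (D n) by exists 0 => _ [z _ <-]; exact: enorm_ge0.
have /choice[v_ vP] n : exists z, F (x_ n) z /\
    euclidean_norm (z - v) < inf (D n) + n.+1%:R^-1.
  have [||_ [z Fz <-] zn] := @inf_adherent R (D n) n.+1%:R^-1.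
  - by rewrite invr_gt0.
  - split => //; have [z Fz] := F0 _ (Xx n).
    by exists (euclidean_norm (z - v)), z.
  by exists z.
exists v_; split=> [n|]; first by have [] := vP n.
apply/cvg_enormP => e e0.
have e20 : 0 < e / 2 by rewrite divr_gt0.
have [d d0 dP] := H _ e20.
move/cvg_enormP : xx0 => /(_ _ d0) xx0.
near=> n.
have /(dP _ (Xx n))[z Fz ze] : euclidean_norm (x_ n - x0) < d by near: n.
have [_ /lt_trans] := vP n; apply; rewrite [ltRHS]splitr ltrD//.
  by apply: le_lt_trans ze; apply: ge_inf => //; exists z.
by near: n; exact: near_inv_lt.
Unshelve. all: by end_near. Qed.

Theorem theorem4p2 (R : realType) (S : ominimal_field_structure R) (k : nat)
    (X : set 'rV[R]_k) (x0 : 'rV[R]_k)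
    (X_closed : closed X) (X_definable : definable S X) (X_x0 : X x0)
    (x0_notin : ~ closure (medial_axis X) x0) :
  tangent_cone X x0 `<=` kuratowski_liminf X x0 (tangent_cone X).
Proof.
have [r r0 x0M] : exists2 r, 0 < r &
    forall b, euclidean_norm (b - x0) < r -> ~ medial_axis X b.
  have /(@nbhs_normP R 'rV[R]_k)[r r0 rM] : nbhs x0 (~` medial_axis X).
    apply: contrapT => h; apply: x0_notin => B Bx0.
    apply: contrapT => MB; apply: h; apply: filterS Bx0 => b Bb Mb.
    by apply: MB; exists b.
  (* The sup norm is at most the Euclidean one, so the Euclidean ball of the same radius also avoids
     the medial axis. *)
  exists r => // b bx0; apply: rM; rewrite /= distrC.
  exact: le_lt_trans (normr_le_enorm _) bx0.
move=> v [y_ [t_ [Xy yx0 t0 t_0 yv]]].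
apply: kuratowski_liminfI => [x Xx|e e0].
  by exists 0; exact: tangent_cone0.
(* The error is split as 2 e' <= e / 2 for replacing v by (y - x) / t, and t M < e / 2 for
   [tangent_cone_approx] after division by t. Since e' <= 1, |y - x| <= t (|v| + 2), whence the
   constant in [M]. *)
pose e' := Num.min 1 (e / 4).
have e'0 : 0 < e' by rewrite lt_min ltr01 divr_gt0.
have /andP[e'1 e'e] : (e' <= 1) && (e' <= e / 4) by rewrite -le_min.
pose M := 2 * (euclidean_norm v + 2) ^+ 2 / r.
have M0 : 0 < M by rewrite divr_gt0// mulr_gt0// exprn_gt0// ltr_wpDl ?enorm_ge0.
have [n [nv nt]] : exists n,
    euclidean_norm ((t_ n)^-1 *: (y_ n - x0) - v) < e' /\ t_ n * M < e / 2.
  have /filter_ex : \forall n \near \oo,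
      euclidean_norm ((t_ n)^-1 *: (y_ n - x0) - v) < e' /\ t_ n < e / 2 / M.
    apply: filterI; first by move/cvg_enormP: yv; exact.
    have /cvgrPdist_lt/(_ _ (divr_gt0 (divr_gt0 e0 _) M0)) := t_0.
    move=> /(_ 2 ltac:(by [])); apply: filterS => n.
    by rewrite sub0r normrN gtr0_norm.
  by move=> [n []]; rewrite ltr_pdivlMr//; exists n.
set y := y_ n in nv *; set t := t_ n in nv nt *.
have {}t0 : 0 < t by exact: t0.
(* One [y] and [t] serve all [x] here: moving the base point from [x0] to [x] costs less than e'
   after division by t. *)
exists (Num.min (r / 2) (t * e')).
  by rewrite lt_min divr_gt0//= mulr_gt0.
move=> x Xx; rewrite lt_min => /andP[xr xt].
have [z xz zyx] := tangent_cone_approx X_closed x0M Xx (Xy n : X y) xr.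
exists (t^-1 *: z); first by apply: tangent_coneZ => //; rewrite invr_gt0.
have yxv : euclidean_norm (t^-1 *: (y - x) - v) < 2 * e'.
  have -> : t^-1 *: (y - x) - v = t^-1 *: (y - x0) - v + t^-1 *: (x0 - x).
    by apply/rowP => i; rewrite !mxE; ring.
  apply: le_lt_trans (enormD _ _) _.
  rewrite enormZ gtr0_norm ?invr_gt0// (enormBC x0).
  have : t^-1 * euclidean_norm (x - x0) < e' by rewrite ltr_pdivrMl.
  lra.
have yxt : euclidean_norm (y - x) <= t * (euclidean_norm v + 2).
  rewrite -ler_pdivrMl//.
  have := enormD (t^-1 *: (y - x) - v) v.
  by rewrite subrK enormZ gtr0_norm ?invr_gt0//; lra.
have zt : euclidean_norm (t^-1 *: z - t^-1 *: (y - x)) <= t * M.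
  rewrite -scalerBr enormZ gtr0_norm ?invr_gt0// ler_pdivrMl//.
  rewrite -(ler_pM2l r0); apply: le_trans zyx _.
  have -> : r * (t * (t * M)) = 2 * (t * (euclidean_norm v + 2)) ^+ 2.
    by rewrite /M; field; rewrite gt_eqF.
  by rewrite ler_pM2l// lerXn2r ?nnegrE ?enorm_ge0// (le_trans _ yxt) ?enorm_ge0.
have := enorm_triangle (t^-1 *: (y - x)) (t^-1 *: z) v; lra.
Qed.
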